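(* There is an algorithm which, given a finite lattice-oriented signature $\mathcal{L}$ and a finite $\mathcal{L}$-lattice $L$ (by the finite tables of its operations), decides whether $L$ has the interpolation property.
   Context: A lattice-oriented signature $\mathcal{L}$ is a finite set of connectives. Each connective $c$ has an arity $n_c\in\mathbb{N}$ and a polarity $p_c:\{1,\dots,n_c\}\to\{-,+\}$. The signature contains binary connectives $\lor,\land,\to$ with $p_\lor(1)=p_\lor(2)=p_\land(1)=p_\land(2)=+$, $p_\to(1)=-$ and $p_\to(2)=+$; nullary connectives are truth constants. A finite $\mathcal{L}$-lattice is a finite set $L$ together with an $n_c$-ary operation $c^L$ on $L$ for each connective $c$, such that: - $(L,\lor^L,\land^L)$ is a lattice, with order $x\le y$ iff $x\land y=x$; its top element is denoted $1$; - $c^L$ is monotone in every argument $i$ with $p_c(i)=+$ and antitone in every argument $i$ with $p_c(i)=-$; - for all $a,b\in L$: $1\le a\to^L b$ iff $a\le b$. Formulas (words) are built from propositional variables using the connectives. A valuation assigns elements of $L$ to the variables and extends to all formulas via the operations $c^L$. For formulas $a,b$, ''$a\le b$ is valid'' means that the value of $a$ is $\le$ the value of $b$ under every valuation. For a valid $a\le b$, the variables occurring only in $a$ are the left variables, those occurring only in $b$ are the right variables, and those occurring in both are the intersection variables. $L$ has the interpolation property iff for all formulas $a,b$ with $a\le b$ valid there is a formula $i$ whose variables are all intersection variables of $a,b$ such that $a\le i$ and $i\le b$ are valid. If there are no intersection variables, $i$ must be a closed formula. *)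

(* Defs.v *)
From Stdlib Require Import Arith List.
Import ListNotations.

(* "There is an algorithm" = there is a mu-recursive program.          *)

Inductive recf : Type :=
| RZero : recf
| RSucc : recf
| RProj : nat -> recf
| RComp : recf -> list recf -> recf
| RPrec : recf -> recf -> recf
| RMu   : recf -> recf.

Inductive ev : recf -> list nat -> nat -> Prop :=
| ev_zero xs : ev RZero xs 0
| ev_succ xs : ev RSucc xs (S (hd 0 xs))
| ev_proj i xs : ev (RProj i) xs (nth i xs 0)
| ev_comp f gs xs ys z :
    Forall2 (fun g y => ev g xs y) gs ys -> ev f ys z -> ev (RComp f gs) xs z
| ev_prec0 f g xs z : ev f xs z -> ev (RPrec f g) (0 :: xs) z
| ev_precS f g n xs y z :
    ev (RPrec f g) (n :: xs) y -> ev g (n :: y :: xs) z ->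
    ev (RPrec f g) (S n :: xs) z
| ev_mu f xs n :
    ev f (n :: xs) 0 -> (forall m, m < n -> exists k, ev f (m :: xs) (S k)) ->
    ev (RMu f) xs n.

(* Finite presentation of a signature together with an L-lattice.      *)
(* Carrier = {0, ..., card-1}.  Connective number 0 is \/, 1 is /\,    *)
(* 2 is ->.  Polarity: true = +, false = -.  The table of an n-ary     *)
(* connective lists the value on (x_1,...,x_n) at the position         *)
(* x_1*card^(n-1) + ... + x_n (lexicographic order).                    *)

Record Conn : Type := MkConn { arity : nat; pol : list bool; table : list nat }.
Record LData : Type := MkLData { card : nat; conns : list Conn }.

Definition conn_of (d : LData) (c : nat) : Conn := nth c (conns d) (MkConn 0 [] []).

Definition tuple_index (d : LData) (xs : list nat) : nat :=
  fold_left (fun acc x => acc * card d + x) xs 0.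

Definition op (d : LData) (c : nat) (xs : list nat) : nat :=
  nth (tuple_index d xs) (table (conn_of d c)) 0.

Definition join d x y := op d 0 [x; y].
Definition meet d x y := op d 1 [x; y].
Definition imp  d x y := op d 2 [x; y].
Definition le (d : LData) (x y : nat) : Prop := meet d x y = x.

Definition elt (d : LData) (x : nat) : Prop := x < card d.
Definition elts (d : LData) (xs : list nat) : Prop := Forall (elt d) xs.

Definition is_L_lattice (d : LData) : Prop :=
  0 < card d /\
  3 <= length (conns d) /\
  conn_of d 0 = MkConn 2 [true; true] (table (conn_of d 0)) /\
  conn_of d 1 = MkConn 2 [true; true] (table (conn_of d 1)) /\
  conn_of d 2 = MkConn 2 [false; true] (table (conn_of d 2)) /\
  (forall c, c < length (conns d) ->
     length (pol (conn_of d c)) = arity (conn_of d c) /\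
     length (table (conn_of d c)) = card d ^ arity (conn_of d c) /\
     Forall (elt d) (table (conn_of d c))) /\
  (forall x y, elt d x -> elt d y ->
     join d x y = join d y x /\ meet d x y = meet d y x /\
     join d x (meet d x y) = x /\ meet d x (join d x y) = x) /\
  (forall x y z, elt d x -> elt d y -> elt d z ->
     join d x (join d y z) = join d (join d x y) z /\
     meet d x (meet d y z) = meet d (meet d x y) z) /\
  (forall c i xs ys, c < length (conns d) -> i < arity (conn_of d c) ->
     elts d xs -> elts d ys ->
     length xs = arity (conn_of d c) -> length ys = arity (conn_of d c) ->
     (forall j, j <> i -> nth j xs 0 = nth j ys 0) ->
     le d (nth i xs 0) (nth i ys 0) ->
     if nth i (pol (conn_of d c)) true
     then le d (op d c xs) (op d c ys)
     else le d (op d c ys) (op d c xs)) /\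
  (exists t, elt d t /\ (forall x, elt d x -> le d x t) /\
     forall a b, elt d a -> elt d b -> (le d t (imp d a b) <-> le d a b)).

Inductive form : Type :=
| Var : nat -> form
| App : nat -> list form -> form.

Fixpoint wf (d : LData) (f : form) : Prop :=
  match f with
  | Var _ => True
  | App c args =>
      c < length (conns d) /\ length args = arity (conn_of d c) /\
      (fix wfl (l : list form) : Prop :=
         match l with [] => True | g :: l' => wf d g /\ wfl l' end) args
  end.

Fixpoint eval (d : LData) (v : nat -> nat) (f : form) : nat :=
  match f with
  | Var n => v n
  | App c args => op d c (map (eval d v) args)
  end.

Fixpoint vars (f : form) : list nat :=
  match f with
  | Var n => [n]
  | App _ args => flat_map vars args
  end.

Definition valid_le (d : LData) (a b : form) : Prop :=
  forall v : nat -> nat, (forall n, elt d (v n)) -> le d (eval d v a) (eval d v b).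

Definition interpolation (d : LData) : Prop :=
  forall a b, wf d a -> wf d b -> valid_le d a b ->
    exists i, wf d i /\
      (forall x, In x (vars i) -> In x (vars a) /\ In x (vars b)) /\
      valid_le d a i /\ valid_le d i b.

Definition cpair (x y : nat) : nat := (x + y) * (x + y + 1) / 2 + y.

Fixpoint code_list (l : list nat) : nat :=
  match l with [] => 0 | x :: l' => S (cpair x (code_list l')) end.

Definition code_conn (c : Conn) : nat :=
  cpair (arity c)
    (cpair (code_list (map (fun b : bool => if b then 1 else 0) (pol c)))
           (code_list (table c))).

Definition code (d : LData) : nat :=
  cpair (card d) (code_list (map code_conn (conns d))).

(* Main.v *)
(* If for any two valuations [v1], [v0] of the shared variables there is a formula
   lying above [a] at [v1] and below [b] at [v0], then the conjunction over [v0] of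
   the disjunctions over [v1] of these formulas is an interpolant. For fixed [v1],
   [v0] the shared variables with the same
   pair of values may be identified, so [|L|^2] of them suffice. The supremum of [a]
   over its left variables is also the supremum over [|L|] variables of the
   disjunction of all substitution instances of [a], and dually for [b]. So it is
   enough to test the term functions in boundedly many variables, and being a term
   function is a bounded quantification over the sets of functions closed under the
   operations; the whole test is primitive recursive. *)

(* A shared variable is remembered by its pair of values because the formula sought is evaluated
   twice, at [v1] against [a] and at [v0] against [b]: an identification is harmless only when both
   valuations respect it. The bound [|L|] on private variables has another source: if the variable
   [m + e] carries the value [e], then sending each private variable to the one indexed by its
   current value reproduces the value of the original formula. Validity survives, because
   substituting independently for the private variables of the two sides gives again an instance of
   [a <= b].

   Formulas are never enumerated by the program. It quantifies over numbers coding tables of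
   functions and over bit masks coding sets of tables; all bounds are expressions in the code of the
   presentation, so no unbounded search occurs. Computability is stated over an arbitrary
   environment type, so that the body of a quantifier obeys the same rules as the whole test, in an
   environment extended by the bound variable. *)
Require Import Defs.
From Stdlib Require Import Arith List Lia Bool Classical Cantor.
Import ListNotations.

(** * Computable functions of an environment *)

(* [f] is computed by a program whose inputs are the values of the variables
   [vs] in the environment. *)
Definition computable {G : Type} (vs : list (G -> nat)) (f : G -> nat) : Prop :=
  exists p, forall g, ev p (map (fun v => v g) vs) (f g).

Definition decidable {G : Type} (vs : list (G -> nat)) (p : G -> bool) : Prop :=
  computable vs (fun g => Nat.b2n (p g)).

Lemma computable_ext {G} (vs : list (G -> nat)) f f' :
  (forall g, f g = f' g) -> computable vs f -> computable vs f'.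
Proof. intros E [p H]; exists p; intro g; rewrite <- E; apply H. Qed.

Lemma computable_var {G} (vs : list (G -> nat)) v : In v vs -> computable vs v.
Proof.
  intros H; destruct (In_nth _ _ (fun _ => 0) H) as [i [Hi E]].
  exists (RProj i); intro g.
  assert (E' : v g = nth i (map (fun v => v g) vs) 0).
  { symmetry; transitivity (nth i vs (fun _ => 0) g); [|now rewrite E].
    apply (map_nth (fun v : G -> nat => v g) vs (fun _ => 0) i). }
  rewrite E'; constructor.
Qed.

(** Composition of programs as a change of environment: each input of the inner program is first
    computed from the outer environment. The call lemmas below are instances; they let a function be
    treated once on bare arguments and then used as a primitive. *)
Lemma computable_subst {G H} (vs : list (G -> nat)) (ws : list (H -> nat))
  (f : H -> nat) (h : G -> H) :
  computable ws f -> Forall (fun w => computable vs (fun g => w (h g))) ws ->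
  computable vs (fun g => f (h g)).
Proof.
  intros [p Hp] Hws.
  assert (exists qs, forall g, Forall2 (fun q y => ev q (map (fun v => v g) vs) y)
            qs (map (fun w => w (h g)) ws)) as [qs Hqs].
  { clear Hp; induction Hws as [|w ws [q Hq] _ [qs IH]].
    - exists []; constructor.
    - exists (q :: qs); intro g; constructor; auto. }
  exists (RComp p qs); intro g; econstructor; [apply Hqs | apply Hp].
Qed.

Lemma computable_call1 {G} (vs : list (G -> nat)) f a :
  computable [fun x => x] f -> computable vs a -> computable vs (fun g => f (a g)).
Proof.
  intros Hf Ha; apply (computable_subst vs _ f a Hf); repeat constructor; auto.
Qed.

Lemma computable_call2 {G} (vs : list (G -> nat)) f a b :
  computable [fst; snd] (fun q => f (fst q) (snd q)) ->
  computable vs a -> computable vs b -> computable vs (fun g => f (a g) (b g)).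
Proof.
  intros Hf Ha Hb.
  apply (computable_subst vs _ _ (fun g => (a g, b g)) Hf); repeat constructor; auto.
Qed.

Lemma computable_call3 {G} (vs : list (G -> nat)) f a b c :
  computable [fun q => fst (fst q); fun q => snd (fst q); snd]
    (fun q => f (fst (fst q)) (snd (fst q)) (snd q)) ->
  computable vs a -> computable vs b -> computable vs c ->
  computable vs (fun g => f (a g) (b g) (c g)).
Proof.
  intros Hf Ha Hb Hc.
  apply (computable_subst vs _ _ (fun g => (a g, b g, c g)) Hf);
    repeat constructor; auto.
Qed.

Lemma computable_succ {G} (vs : list (G -> nat)) a :
  computable vs a -> computable vs (fun g => S (a g)).
Proof.
  intros Ha; apply (computable_call1 vs S a); [|exact Ha].
  exists RSucc; intro x; apply (ev_succ [x]).
Qed.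

Lemma computable_const {G} (vs : list (G -> nat)) k : computable vs (fun _ => k).
Proof.
  induction k as [|k IH].
  - exists RZero; intro; constructor.
  - now apply computable_succ.
Qed.

(** With [xs] empty this is the identity program on the environment, needed to pass the parameters
    to [RPrec]. The prefix serves the induction, where projection indices start at its length. *)
Lemma ev_projections xs ys :
  Forall2 (fun q y => ev q (xs ++ ys) y)
    (map RProj (seq (length xs) (length ys))) ys.
Proof.
  revert xs; induction ys as [|y ys IH]; intro xs; simpl; constructor.
  - replace y with (nth (length xs) (xs ++ y :: ys) 0) at 2 by apply nth_middle.
    constructor.
  - replace (xs ++ y :: ys) with ((xs ++ [y]) ++ ys) by now rewrite <- app_assoc.
    replace (S (length xs)) with (length (xs ++ [y])) by (rewrite length_app; simpl; lia).
    apply IH.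
Qed.

Definition primrec (z : nat) (s : nat -> nat -> nat) (n : nat) : nat :=
  nat_rec (fun _ => nat) z s n.

Lemma computable_primrec {G} (vs : list (G -> nat)) n z s :
  computable vs n -> computable vs z ->
  computable ((fun q => fst q) :: (fun q => fst (snd q)) ::
                map (fun v q => v (snd (snd q))) vs)
    (fun q : nat * (nat * G) => s (fst q) (fst (snd q)) (snd (snd q))) ->
  computable vs (fun g => primrec (z g) (fun i acc => s i acc g) (n g)).
Proof.
  intros [pn Hn] [pz Hz] [ps Hs].
  exists (RComp (RPrec pz ps) (pn :: map RProj (seq 0 (length vs)))); intro g.
  apply ev_comp with (n g :: map (fun v => v g) vs).
  - constructor; [apply Hn|].
    generalize (ev_projections [] (map (fun v => v g) vs)).
    now rewrite length_map.
  - generalize (n g); intro k; induction k as [|k IH]; simpl.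
    + constructor; apply Hz.
    + econstructor; [exact IH|].
      specialize (Hs (k, (primrec (z g) (fun i acc => s i acc g) k, g))).
      simpl in Hs; rewrite map_map in Hs; exact Hs.
Qed.

Lemma computable_add {G} (vs : list (G -> nat)) a b :
  computable vs a -> computable vs b -> computable vs (fun g => a g + b g).
Proof.
  intros Ha Hb; eapply computable_ext with (fun g => primrec (a g) (fun _ acc => S acc) (b g)).
  - intro g; induction (b g) as [|k IH]; simpl; lia.
  - apply (computable_primrec vs b a (fun _ acc _ => S acc)); auto.
    apply computable_succ, computable_var; simpl; auto.
Qed.

Lemma computable_mul {G} (vs : list (G -> nat)) a b :
  computable vs a -> computable vs b -> computable vs (fun g => a g * b g).
Proof.
  apply (computable_call2 vs Nat.mul).
  eapply computable_ext with (fun g => primrec 0 (fun _ acc => acc + snd g) (fst g)).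
  - intro g; induction (fst g) as [|k IH]; simpl in *; lia.
  - apply (computable_primrec _ fst (fun _ => 0) (fun _ acc g => acc + snd g)).
    + apply computable_var; simpl; auto.
    + apply computable_const.
    + apply computable_add; apply computable_var; simpl; auto.
Qed.

Lemma computable_pred {G} (vs : list (G -> nat)) a :
  computable vs a -> computable vs (fun g => pred (a g)).
Proof.
  apply (computable_call1 vs pred).
  eapply computable_ext with (fun g => primrec 0 (fun i _ => i) g).
  - intros [|k]; reflexivity.
  - apply (computable_primrec _ (fun g => g) (fun _ => 0) (fun i _ _ => i)).
    + apply computable_var; simpl; auto.
    + apply computable_const.
    + apply computable_var; simpl; auto.
Qed.

Lemma computable_sub {G} (vs : list (G -> nat)) a b :
  computable vs a -> computable vs b -> computable vs (fun g => a g - b g).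
Proof.
  intros Ha Hb; eapply computable_ext with (fun g => primrec (a g) (fun _ acc => pred acc) (b g)).
  - intro g; induction (b g) as [|k IH]; simpl; lia.
  - apply (computable_primrec vs b a (fun _ acc _ => pred acc)); auto.
    apply computable_pred, computable_var; simpl; auto.
Qed.

Lemma computable_pow {G} (vs : list (G -> nat)) a b :
  computable vs a -> computable vs b -> computable vs (fun g => a g ^ b g).
Proof.
  apply (computable_call2 vs Nat.pow).
  eapply computable_ext with (fun g => primrec 1 (fun _ acc => fst g * acc) (snd g)).
  - intro g; induction (snd g) as [|k IH]; simpl in *; auto.
  - apply (computable_primrec _ snd (fun _ => 1) (fun _ acc g => fst g * acc)).
    + apply computable_var; simpl; auto.
    + apply computable_const.
    + apply computable_mul; apply computable_var; simpl; auto.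
Qed.

Lemma decidable_leb {G} (vs : list (G -> nat)) a b :
  computable vs a -> computable vs b -> decidable vs (fun g => a g <=? b g).
Proof.
  intros Ha Hb; apply computable_ext with (fun g => 1 - (a g - b g)).
  - intro g; destruct (Nat.leb_spec (a g) (b g)); cbn [Nat.b2n]; lia.
  - auto using computable_sub, computable_const.
Qed.

Lemma decidable_eqb {G} (vs : list (G -> nat)) a b :
  computable vs a -> computable vs b -> decidable vs (fun g => a g =? b g).
Proof.
  intros Ha Hb; apply computable_ext with (fun g => 1 - ((a g - b g) + (b g - a g))).
  - intro g; destruct (Nat.eqb_spec (a g) (b g)); cbn [Nat.b2n]; lia.
  - auto using computable_sub, computable_add, computable_const.
Qed.

Lemma decidable_negb {G} (vs : list (G -> nat)) p :
  decidable vs p -> decidable vs (fun g => negb (p g)).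
Proof.
  intros Hp; apply computable_ext with (fun g => 1 - Nat.b2n (p g)).
  - intro g; now destruct (p g).
  - apply computable_sub; [apply computable_const | exact Hp].
Qed.

Lemma decidable_andb {G} (vs : list (G -> nat)) p q :
  decidable vs p -> decidable vs q -> decidable vs (fun g => p g && q g).
Proof.
  intros Hp Hq; apply computable_ext with (fun g => Nat.b2n (p g) * Nat.b2n (q g)).
  - intro g; now destruct (p g), (q g).
  - now apply computable_mul.
Qed.

Lemma decidable_implb {G} (vs : list (G -> nat)) p q :
  decidable vs p -> decidable vs q -> decidable vs (fun g => implb (p g) (q g)).
Proof.
  intros Hp Hq.
  apply computable_ext with (fun g => Nat.b2n (negb (p g && negb (q g)))).
  - intro g; now destruct (p g), (q g).
  - apply decidable_negb, decidable_andb; [|apply decidable_negb]; auto.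
Qed.

(** * Bounded quantifiers and sums *)

Definition ball (n : nat) (p : nat -> bool) : bool := forallb p (seq 0 n).
Definition bex (n : nat) (p : nat -> bool) : bool := negb (ball n (fun i => negb (p i))).
Definition bsum (n : nat) (f : nat -> nat) : nat := primrec 0 (fun i acc => acc + f i) n.

Lemma ball_true n p : ball n p = true <-> forall i, i < n -> p i = true.
Proof.
  unfold ball; rewrite forallb_forall; split; intros H i Hi; apply H.
  - apply in_seq; lia.
  - apply in_seq in Hi; lia.
Qed.

Lemma bex_true n p : bex n p = true <-> exists i, i < n /\ p i = true.
Proof.
  unfold bex; rewrite negb_true_iff, <- not_true_iff_false, ball_true; split.
  - intro H; apply NNPP; intro H'; apply H; intros i Hi.
    destruct (p i) eqn:E; [exfalso; eauto | reflexivity].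
  - intros (i & Hi & E) H; specialize (H i Hi); now rewrite E in H.
Qed.

Lemma decidable_ball {G} (vs : list (G -> nat)) n p :
  computable vs n ->
  decidable ((fun q => fst q) :: map (fun v q => v (snd q)) vs)
    (fun q : nat * G => p (fst q) (snd q)) ->
  decidable vs (fun g => ball (n g) (fun i => p i g)).
Proof.
  intros Hn Hp.
  apply computable_ext with
    (fun g => primrec 1 (fun i acc => acc * Nat.b2n (p i g)) (n g)).
  - intro g; induction (n g) as [|k IH]; [reflexivity|].
    unfold ball in *; rewrite seq_S, forallb_app; simpl; rewrite IH.
    now destruct (forallb _ _), (p k g).
  - apply (computable_primrec vs n (fun _ => 1) (fun i acc g => acc * Nat.b2n (p i g)));
      [exact Hn | apply computable_const | apply computable_mul].
    + apply computable_var; simpl; auto.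
    + apply (computable_subst _ _ (fun q => Nat.b2n (p (fst q) (snd q)))
               (fun q : nat * (nat * G) => (fst q, snd (snd q))) Hp).
      constructor; [apply computable_var; simpl; auto|].
      apply Forall_forall; intros w Hw; apply in_map_iff in Hw.
      destruct Hw as (v & <- & Hv); apply computable_var; simpl; right; right.
      apply in_map_iff; eauto.
Qed.

Lemma decidable_bex {G} (vs : list (G -> nat)) n p :
  computable vs n ->
  decidable ((fun q => fst q) :: map (fun v q => v (snd q)) vs)
    (fun q : nat * G => p (fst q) (snd q)) ->
  decidable vs (fun g => bex (n g) (fun i => p i g)).
Proof.
  intros Hn Hp; apply decidable_negb.
  apply (decidable_ball vs n (fun i g => negb (p i g))); [exact Hn|].
  now apply (decidable_negb _ (fun q => p (fst q) (snd q))).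
Qed.

Lemma computable_bsum {G} (vs : list (G -> nat)) n f :
  computable vs n ->
  computable ((fun q => fst q) :: map (fun v q => v (snd q)) vs)
    (fun q : nat * G => f (fst q) (snd q)) ->
  computable vs (fun g => bsum (n g) (fun i => f i g)).
Proof.
  intros Hn Hp.
  apply (computable_primrec vs n (fun _ => 0) (fun i acc g => acc + f i g));
    [exact Hn | apply computable_const | apply computable_add].
  - apply computable_var; simpl; auto.
  - apply (computable_subst _ _ (fun q => f (fst q) (snd q))
             (fun q : nat * (nat * G) => (fst q, snd (snd q))) Hp).
    constructor; [apply computable_var; simpl; auto|].
    apply Forall_forall; intros w Hw; apply in_map_iff in Hw.
    destruct Hw as (v & <- & Hv); apply computable_var; simpl; right; right.
    apply in_map_iff; eauto.
Qed.

Lemma bsum_ext n f f' : (forall i, i < n -> f i = f' i) -> bsum n f = bsum n f'.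
Proof.
  intro H; induction n as [|n IH]; [reflexivity|].
  change (bsum n f + f n = bsum n f' + f' n); rewrite IH, H; auto.
Qed.

(** This replaces search: summing a value times the indicator of a property that only one index has
    returns the value at that index. *)
Lemma bsum_unique n f k :
  k < n -> (forall i, i < n -> i <> k -> f i = 0) -> bsum n f = f k.
Proof.
  intros Hk H.
  assert (Z : forall j, j <= k -> bsum j f = 0).
  { induction j as [|j IH]; [reflexivity|]; intro.
    change (bsum j f + f j = 0); rewrite IH, H; lia. }
  induction n as [|n IH]; [lia|].
  change (bsum n f + f n = f k).
  destruct (Nat.eq_dec n k) as [->|]; [rewrite Z; lia|].
  rewrite IH, (H n); auto; lia.
Qed.

Ltac solve_var := apply computable_var; simpl; repeat (first [left; reflexivity | right]).

(* Dispatch on the head symbol, so that no definition is unfolded by unification. *)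
Ltac compute_step :=
  lazymatch goal with
  | |- Forall _ _ => constructor
  | |- decidable _ (fun g => ball (@?n g) (fun i => @?p i g)) =>
      apply (decidable_ball _ n (fun i g => p i g))
  | |- decidable _ (fun g => bex (@?n g) (fun i => @?p i g)) =>
      apply (decidable_bex _ n (fun i g => p i g))
  | |- decidable _ (fun g => implb (@?p g) (@?q g)) => apply (decidable_implb _ p q)
  | |- decidable _ (fun g => andb (@?p g) (@?q g)) => apply (decidable_andb _ p q)
  | |- decidable _ (fun g => negb (@?p g)) => apply (decidable_negb _ p)
  | |- decidable _ (fun g => Nat.eqb (@?a g) (@?b g)) => apply (decidable_eqb _ a b)
  | |- decidable _ (fun g => Nat.leb (@?a g) (@?b g)) => apply (decidable_leb _ a b)
  | |- decidable _ (fun g => Nat.ltb (@?a g) (@?b g)) =>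
      apply (decidable_leb _ (fun g => S (a g)) b)
  | |- computable ?vs (fun g => Nat.b2n (@?p g)) => change (decidable vs p)
  | |- computable _ (fun _ => ?k) => apply computable_const
  | |- computable _ (fun g => bsum (@?n g) (fun i => @?f i g)) =>
      apply (computable_bsum _ n (fun i g => f i g))
  | |- computable _ (fun g => primrec (@?z g) (fun i acc => @?s i acc g) (@?n g)) =>
      apply (computable_primrec _ n z (fun i acc g => s i acc g))
  | |- computable _ (fun g => Nat.add (@?a g) (@?b g)) => apply (computable_add _ a b)
  | |- computable _ (fun g => Nat.mul (@?a g) (@?b g)) => apply (computable_mul _ a b)
  | |- computable _ (fun g => Nat.sub (@?a g) (@?b g)) => apply (computable_sub _ a b)
  | |- computable _ (fun g => Nat.pow (@?a g) (@?b g)) => apply (computable_pow _ a b)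
  | |- computable _ (fun g => Nat.pred (@?a g)) => apply (computable_pred _ a)
  | |- computable _ (fun g => S (@?a g)) => apply (computable_succ _ a)
  end; cbv beta.

Ltac compute_tac step := repeat (first [step | compute_step | solve [solve_var]]).

Lemma computable_div {G} (vs : list (G -> nat)) a b :
  computable vs a -> computable vs b -> computable vs (fun g => a g / b g).
Proof.
  apply (computable_call2 vs Nat.div).
  (* The quotient is the number of positive multiples of the divisor that do not exceed the
     dividend. The guard on the divisor yields the convention [x / 0 = 0]. *)
  apply computable_ext with (fun q : nat * nat =>
    bsum (fst q) (fun i => Nat.b2n ((1 <=? snd q) && (S i * snd q <=? fst q)))).
  - intros [x y]; simpl.
    destruct y as [|y].
    { transitivity (bsum x (fun _ => 0)); [now apply bsum_ext|].
      clear; induction x as [|x IH]; [reflexivity|].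
      change (bsum x (fun _ => 0) + 0 = 0); now rewrite IH. }
    assert (H : forall k, bsum k (fun i => Nat.b2n (S i * S y <=? x)) = Nat.min k (x / S y)).
    { induction k as [|k IH]; [reflexivity|].
      change (bsum k (fun i => Nat.b2n (S i * S y <=? x)) + Nat.b2n (S k * S y <=? x) =
                Nat.min (S k) (x / S y)).
      rewrite IH.
      pose proof (Nat.div_mod_eq x (S y)); pose proof (Nat.mod_upper_bound x (S y)).
      set (q := x / S y) in *; set (r := x mod S y) in *.
      destruct (Nat.leb_spec (S k * S y) x); simpl Nat.b2n.
      - assert (k < q) by nia; lia.
      - assert (q <= k) by nia; lia. }
    transitivity (bsum x (fun i => Nat.b2n (S i * S y <=? x))); [now apply bsum_ext|].
    rewrite H; apply Nat.min_r, Nat.Div0.div_le_upper_bound; nia.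
  - compute_tac fail.
Qed.

Lemma computable_mod {G} (vs : list (G -> nat)) a b :
  computable vs a -> computable vs b -> computable vs (fun g => a g mod b g).
Proof.
  intros Ha Hb; apply computable_ext with (fun g => a g - b g * (a g / b g)).
  - intro g; pose proof (Nat.div_mod_eq (a g) (b g)); lia.
  - apply computable_sub, computable_mul, computable_div; auto.
Qed.

(** * Decoding *)

(** Gives access to the inverse of the library's Cantor bijection and its laws. The product is
    rewritten as an explicit double, so that halving is exact. *)
Lemma cpair_to_nat x y : cpair x y = to_nat (x, y).
Proof.
  unfold cpair; pose proof (to_nat_spec x y) as H.
  replace ((x + y) * (x + y + 1)) with ((to_nat (x, y) - y) * 2) by nia.
  rewrite Nat.div_mul by lia; pose proof (to_nat_non_decreasing x y); lia.
Qed.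

Definition cfst (z : nat) : nat := fst (of_nat z).
Definition csnd (z : nat) : nat := snd (of_nat z).

Lemma cfst_cpair x y : cfst (cpair x y) = x.
Proof. unfold cfst; now rewrite cpair_to_nat, cancel_of_to. Qed.

Lemma csnd_cpair x y : csnd (cpair x y) = y.
Proof. unfold csnd; now rewrite cpair_to_nat, cancel_of_to. Qed.

Lemma cpair_ge x y : x + y <= cpair x y.
Proof. rewrite cpair_to_nat; pose proof (to_nat_non_decreasing x y); lia. Qed.

Lemma cpair_surj z : cpair (cfst z) (csnd z) = z.
Proof.
  rewrite cpair_to_nat; unfold cfst, csnd; rewrite <- surjective_pairing.
  apply cancel_to_of.
Qed.

(** Both components are at most [z], so the double sum meets the right pair, and the indicator kills
    all other terms. This gives a primitive recursive form of the projections, which are defined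
    through [of_nat]. *)
Lemma bsum_cpair z (f : nat -> nat -> nat) :
  bsum (S z) (fun x => bsum (S z) (fun y => f x y * Nat.b2n (cpair x y =? z))) =
  f (cfst z) (csnd z).
Proof.
  pose proof (cpair_ge (cfst z) (csnd z)) as H; rewrite cpair_surj in H.
  assert (Z : forall x y, x <> cfst z \/ y <> csnd z -> (cpair x y =? z) = false).
  { intros x y N; apply Nat.eqb_neq; intro E; subst z.
    rewrite cfst_cpair, csnd_cpair in N; tauto. }
  rewrite bsum_unique with (k := cfst z); [|lia|].
  - rewrite bsum_unique with (k := csnd z); [|lia|].
    + rewrite cpair_surj, Nat.eqb_refl; simpl; lia.
    + intros y _ N; rewrite Z by auto; simpl; lia.
  - intros x _ N; rewrite bsum_unique with (k := 0); [|lia|];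
      intros; rewrite Z by auto; simpl; lia.
Qed.

Lemma computable_cpair {G} (vs : list (G -> nat)) a b :
  computable vs a -> computable vs b -> computable vs (fun g => cpair (a g) (b g)).
Proof.
  intros Ha Hb; unfold cpair.
  apply computable_add; [apply computable_div|exact Hb];
    repeat first [assumption | compute_step].
Qed.

Lemma computable_cfst {G} (vs : list (G -> nat)) a :
  computable vs a -> computable vs (fun g => cfst (a g)).
Proof.
  apply (computable_call1 vs cfst).
  apply computable_ext with (fun z => bsum (S z) (fun x => bsum (S z) (fun y =>
     x * Nat.b2n (cpair x y =? z)))).
  - intro z; apply (bsum_cpair z (fun x _ => x)).
  - compute_tac ltac:(idtac; lazymatch goal with
    | |- computable _ (fun g => cpair (@?a g) (@?b g)) => apply (computable_cpair _ a b)
    end).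
Qed.

Lemma computable_csnd {G} (vs : list (G -> nat)) a :
  computable vs a -> computable vs (fun g => csnd (a g)).
Proof.
  apply (computable_call1 vs csnd).
  apply computable_ext with (fun z => bsum (S z) (fun x => bsum (S z) (fun y =>
     y * Nat.b2n (cpair x y =? z)))).
  - intro z; apply (bsum_cpair z (fun _ y => y)).
  - compute_tac ltac:(idtac; lazymatch goal with
    | |- computable _ (fun g => cpair (@?a g) (@?b g)) => apply (computable_cpair _ a b)
    end).
Qed.

(* [pred 0 = 0] is the code of the pair (0, 0), so the empty list has head and tail 0. *)
Definition ltail (l i : nat) : nat := primrec l (fun _ acc => csnd (pred acc)) i.
Definition lnth (l i : nat) : nat := cfst (pred (ltail l i)).

Lemma ltail_code l i : ltail (code_list l) i = code_list (skipn i l).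
Proof.
  induction i as [|i IH]; [reflexivity|].
  change (csnd (pred (ltail (code_list l) i)) = code_list (skipn (S i) l)).
  rewrite IH; clear IH; revert l; induction i as [|i IH]; intros [|x l]; try reflexivity.
  - apply csnd_cpair.
  - apply IH.
Qed.

Lemma lnth_code l i : lnth (code_list l) i = nth i l 0.
Proof.
  unfold lnth; rewrite ltail_code; revert i; induction l as [|x l IH]; intros [|i];
    try reflexivity.
  - apply cfst_cpair.
  - apply IH.
Qed.

Lemma length_code_list l : length l <= code_list l.
Proof.
  induction l as [|x l IH]; simpl; [lia|].
  pose proof (cpair_ge x (code_list l)); lia.
Qed.

(** * Reading a presentation from its code *)

Definition dcard (D : nat) : nat := cfst D.
Definition dconn (D c : nat) : nat := lnth (csnd D) c.
(** Only a nonempty list has a positive code, so a positive tail after [c] entries certifies that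
    [c] is an index; the length is never computed. *)
Definition dis_conn (D c : nat) : bool := 1 <=? ltail (csnd D) c.
Definition darity (D c : nat) : nat := cfst (dconn D c).
Definition dtable (D c i : nat) : nat := lnth (csnd (csnd (dconn D c))) i.

Lemma dcard_code d : dcard (code d) = card d.
Proof. apply cfst_cpair. Qed.

Lemma dconn_code d c : dconn (code d) c = code_conn (conn_of d c).
Proof.
  unfold dconn, code; rewrite csnd_cpair, lnth_code.
  (* The default connective has code 0, so the defaults of both lookups match. *)
  change 0 with (code_conn (MkConn 0 [] [])); apply map_nth.
Qed.

Lemma darity_code d c : darity (code d) c = arity (conn_of d c).
Proof. unfold darity; rewrite dconn_code; apply cfst_cpair. Qed.

Lemma dtable_code d c i : dtable (code d) c i = nth i (table (conn_of d c)) 0.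
Proof.
  unfold dtable; rewrite dconn_code; unfold code_conn.
  now rewrite !csnd_cpair, lnth_code.
Qed.

Lemma dis_conn_code d c : dis_conn (code d) c = true <-> c < length (conns d).
Proof.
  unfold dis_conn, code; rewrite csnd_cpair, ltail_code, Nat.leb_le, skipn_map.
  rewrite <- (Nat.sub_0_r (length _)).
  pose proof (length_skipn c (conns d)).
  destruct (skipn c (conns d)); simpl in *; lia.
Qed.

(** The code itself can thus bound the quantifier over connectives in [clone_closed]. *)
Lemma length_conns_code d : length (conns d) <= code d.
Proof.
  unfold code; pose proof (cpair_ge (card d) (code_list (map code_conn (conns d)))).
  pose proof (length_code_list (map code_conn (conns d))) as H'.
  rewrite length_map in H'; lia.
Qed.

(** * The decision procedure *)

(** Position 0 is the least significant digit, so a point is extended by further coordinates by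
    adding a multiple of a power of the base. *)
Definition digit (b x i : nat) : nat := (x / b ^ i) mod b.

Definition member (s x : nat) : bool := digit 2 s x =? 1.

(** Horner's scheme, first entry most significant, as in [tuple_index]. [F] packs [k] functions as
    digits in base [M]; their values at the point [t] form the argument tuple. *)
Definition row_index (n M F t k : nat) : nat :=
  primrec 0 (fun i acc => acc * n + digit n (digit M F i) t) k.

Definition dle (D x y : nat) : bool := dtable D 1 (x * dcard D + y) =? x.

(* Functions [L^k -> L] are coded by numbers below this bound: a point of [L^k]
   is a number [t] with [k] digits in base [|L|], and the value at [t] is the
   [t]-th digit of the code. *)
Definition nfun (n k : nat) : nat := n ^ n ^ k.

Definition projection (n k g j : nat) : bool :=
  ball (n ^ k) (fun t => digit n g t =? digit n t j).

(** [R] is described by its values rather than computed, and all arguments are packed into the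
    single number [F], so that one quantifier serves every arity. *)
Definition application (D n k c F R : nat) : bool :=
  ball (n ^ k) (fun t =>
    digit n R t =? dtable D c (row_index n (nfun n k) F t (darity D c))).

(** Such sets are the subalgebras of [L^(L^k)] containing the projections; the least one consists of
    the term functions. It is empty when [k = 0] and there are no constants, which accounts for the
    absence of closed formulas. *)
Definition clone_closed (D k s : nat) : bool :=
  ball k (fun j => ball (nfun (dcard D) k) (fun g =>
    implb (projection (dcard D) k g j) (member s g))) &&
  ball D (fun c => implb (dis_conn D c)
    (ball (nfun (dcard D) k ^ darity D c) (fun F =>
      implb (ball (darity D c) (fun i => member s (digit (nfun (dcard D) k) F i)))
        (ball (nfun (dcard D) k) (fun R =>
          implb (application D (dcard D) k c F R) (member s R)))))).

Definition term_function (D k a : nat) : bool :=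
  ball (2 ^ nfun (dcard D) k) (fun s => implb (clone_closed D k s) (member s a)).

(** [u] holds the values of the shared variables, [x] and [z] the private values of [a] and of [b];
    adding [n ^ m * x] appends the digits of [x] to those of [u]. *)
Definition valid_table (D n m a b : nat) : bool :=
  ball (n ^ m) (fun u => ball (n ^ n) (fun x => ball (n ^ n) (fun z =>
    dle D (digit n a (u + n ^ m * x)) (digit n b (u + n ^ m * z))))).

(** One [x] serves both inequalities, since each involves the private variables of one side only. *)
Definition interpolant_table (D n m a b i : nat) : bool :=
  ball (n ^ m) (fun u => ball (n ^ n) (fun x =>
    dle D (digit n a (u + n ^ m * x)) (digit n i u) &&
    dle D (digit n i u) (digit n b (u + n ^ m * x)))).

Definition interpolation_test (D : nat) : bool :=
  ball (S (dcard D * dcard D)) (fun m =>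
    ball (nfun (dcard D) (m + dcard D)) (fun a =>
      ball (nfun (dcard D) (m + dcard D)) (fun b =>
        implb (term_function D (m + dcard D) a)
          (implb (term_function D (m + dcard D) b)
            (implb (valid_table D (dcard D) m a b)
              (bex (nfun (dcard D) m) (fun i =>
                term_function D m i && interpolant_table D (dcard D) m a b i))))))).

(** * Computability of the test *)

Lemma computable_digit {G} (vs : list (G -> nat)) b x i :
  computable vs b -> computable vs x -> computable vs i ->
  computable vs (fun g => digit (b g) (x g) (i g)).
Proof.
  intros; unfold digit; auto using computable_mod, computable_div, computable_pow.
Qed.

Lemma computable_ltail {G} (vs : list (G -> nat)) l i :
  computable vs l -> computable vs i -> computable vs (fun g => ltail (l g) (i g)).
Proof.
  apply (computable_call2 vs ltail); unfold ltail.
  compute_tac ltac:(idtac; lazymatch goal with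
    | |- computable _ (fun g => csnd (@?a g)) => apply (computable_csnd _ a)
    end).
Qed.

Lemma computable_lnth {G} (vs : list (G -> nat)) l i :
  computable vs l -> computable vs i -> computable vs (fun g => lnth (l g) (i g)).
Proof. intros; apply computable_cfst, computable_pred, computable_ltail; auto. Qed.

Lemma computable_darity {G} (vs : list (G -> nat)) a b :
  computable vs a -> computable vs b -> computable vs (fun g => darity (a g) (b g)).
Proof. intros; apply computable_cfst, computable_lnth; [apply computable_csnd|]; auto. Qed.

Lemma computable_dtable {G} (vs : list (G -> nat)) a b i :
  computable vs a -> computable vs b -> computable vs i ->
  computable vs (fun g => dtable (a g) (b g) (i g)).
Proof.
  intros; apply computable_lnth; auto.
  apply computable_csnd, computable_csnd, computable_lnth; auto.
  apply computable_csnd; auto.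
Qed.

Ltac compute_data_step :=
  lazymatch goal with
  | |- computable _ (fun g => digit (@?a g) (@?b g) (@?c g)) => apply (computable_digit _ a b c)
  | |- computable _ (fun g => cfst (@?a g)) => apply (computable_cfst _ a)
  | |- computable _ (fun g => csnd (@?a g)) => apply (computable_csnd _ a)
  | |- computable _ (fun g => ltail (@?a g) (@?b g)) => apply (computable_ltail _ a b)
  | |- computable _ (fun g => darity (@?a g) (@?b g)) => apply (computable_darity _ a b)
  | |- computable _ (fun g => dtable (@?a g) (@?b g) (@?c g)) => apply (computable_dtable _ a b c)
  | |- computable _ (fun g => dcard (@?a g)) => apply (computable_cfst _ a)
  end; cbv beta.

Lemma decidable_term_function {G} (vs : list (G -> nat)) D k a :
  computable vs D -> computable vs k -> computable vs a ->
  decidable vs (fun g => term_function (D g) (k g) (a g)).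
Proof.
  apply (computable_call3 vs (fun D k a => Nat.b2n (term_function D k a))).
  unfold term_function, clone_closed, projection, application, row_index, member,
    dis_conn, nfun.
  compute_tac compute_data_step.
Qed.

Lemma decidable_interpolation_test :
  decidable [fun D => D] interpolation_test.
Proof.
  unfold interpolation_test, valid_table, interpolant_table, dle, nfun.
  compute_tac ltac:(idtac; first [compute_data_step |
    lazymatch goal with
    | |- decidable _ (fun g => term_function (@?a g) (@?b g) (@?c g)) =>
        apply (decidable_term_function _ a b c)
    end]).
Qed.

(** * Digits *)

Lemma digit_lt b x i : 0 < b -> digit b x i < b.
Proof. intro; apply Nat.mod_upper_bound; lia. Qed.

Lemma digits_exist b f k :
  0 < b -> (forall i, i < k -> f i < b) ->
  exists x, x < b ^ k /\ forall i, i < k -> digit b x i = f i.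
Proof.
  intros Hb; revert f; induction k as [|k IH]; intros f Hf.
  - exists 0; simpl; split; lia.
  - destruct (IH (fun i => f (S i))) as (x & Hx & E); [intros; apply Hf; lia|].
    pose proof (Hf 0 ltac:(lia)) as H0.
    exists (f 0 + x * b); split; [simpl; nia|].
    intros [|i] Hi; unfold digit.
    + rewrite Nat.pow_0_r, Nat.div_1_r, Nat.Div0.mod_add; now apply Nat.mod_small.
    + rewrite Nat.pow_succ_r', <- Nat.Div0.div_div, Nat.div_add by lia.
      rewrite (Nat.div_small (f 0)) by lia; apply E; lia.
Qed.

Lemma digit_append n m u x j :
  0 < n -> u < n ^ m ->
  digit n (u + n ^ m * x) j = if j <? m then digit n u j else digit n x (j - m).
Proof.
  intros Hn Hu; unfold digit; destruct (Nat.ltb_spec j m).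
  (* Here [n ^ m * x] is a multiple of [n ^ (j + 1)], so it does not affect digit [j]. *)
  - replace (n ^ m) with (n ^ j * (n * n ^ (m - S j))).
    2: { rewrite <- Nat.pow_succ_r', <- Nat.pow_add_r; f_equal; lia. }
    replace (u + n ^ j * (n * n ^ (m - S j)) * x)
      with (u + (n ^ (m - S j) * x * n) * n ^ j) by nia.
    rewrite Nat.div_add by (apply Nat.pow_nonzero; lia).
    apply Nat.Div0.mod_add.
  - replace (n ^ j) with (n ^ m * n ^ (j - m)) by (rewrite <- Nat.pow_add_r; f_equal; lia).
    rewrite <- Nat.Div0.div_div; do 2 f_equal.
    symmetry; apply Nat.div_unique with u; lia.
Qed.

Lemma append_lt n m k u x :
  u < n ^ m -> x < n ^ k -> u + n ^ m * x < n ^ (m + k).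
Proof. rewrite Nat.pow_add_r; nia. Qed.

(** Induction on [N] makes finitely many choices without a choice axiom and without deciding [Q]. *)
Lemma bounded_choice {A} (a0 : A) (Q : nat -> A -> Prop) N :
  (forall t, t < N -> exists a, Q t a) -> exists F, forall t, t < N -> Q t (F t).
Proof.
  induction N as [|N IH]; intro H.
  - exists (fun _ => a0); lia.
  - destruct IH as [F HF]; [auto|]; destruct (H N) as [a Ha]; [lia|].
    exists (fun t => if t =? N then a else F t); intros t Ht.
    destruct (Nat.eqb_spec t N) as [->|]; [exact Ha | apply HF; lia].
Qed.

(** The bits are chosen by excluded middle. The intended [P] is being the table of some formula, the
    very property that the program has to decide. *)
Lemma bitmask_exists (P : nat -> Prop) k :
  exists x, x < 2 ^ k /\ forall i, i < k -> (member x i = true <-> P i).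
Proof.
  destruct (bounded_choice 0 (fun i b => b < 2 /\ (b = 1 <-> P i)) k) as [f Hf].
  { intros i _; destruct (classic (P i)); [exists 1 | exists 0];
      split; try lia; split; intro; auto; try lia; contradiction. }
  destruct (digits_exist 2 f k) as (x & Hx & E); [lia | intros; now apply Hf|].
  exists x; split; [exact Hx|]; intros i Hi; unfold member.
  rewrite Nat.eqb_eq, E by exact Hi; now apply Hf.
Qed.

(** * Formulas *)

Lemma form_nested_ind (P : form -> Prop) :
  (forall n, P (Var n)) ->
  (forall c args, (forall f, In f args -> P f) -> P (App c args)) ->
  forall f, P f.
Proof.
  intros HV HA; fix IH 1; intros [n|c args]; [apply HV | apply HA].
  induction args as [|g args IHa]; intros f Hf; [destruct Hf|].
  destruct Hf as [<-|Hf]; [apply IH | now apply IHa].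
Qed.

Lemma wf_App d c args :
  wf d (App c args) <->
  c < length (conns d) /\ length args = arity (conn_of d c) /\
  (forall f, In f args -> wf d f).
Proof.
  simpl; do 2 apply and_iff_compat_l.
  induction args as [|g args IH]; simpl; [firstorder|].
  rewrite IH; split; [intros [Hg H] f [<-|Hf] | intro H; split]; auto.
Qed.

Lemma eval_ext d v v' f :
  (forall x, In x (vars f) -> v x = v' x) -> eval d v f = eval d v' f.
Proof.
  induction f as [n|c args IH] using form_nested_ind; intro H; simpl.
  - apply H; simpl; auto.
  - f_equal; apply map_ext_in; intros f Hf; apply IH; [exact Hf|].
    intros x Hx; apply H; simpl; apply in_flat_map; eauto.
Qed.

Fixpoint rename (r : nat -> nat) (f : form) : form :=
  match f with
  | Var n => Var (r n)
  | App c args => App c (map (rename r) args)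
  end.

Lemma eval_rename d v r f : eval d v (rename r f) = eval d (fun x => v (r x)) f.
Proof.
  induction f as [n|c args IH] using form_nested_ind; simpl; [reflexivity|].
  f_equal; rewrite map_map; now apply map_ext_in.
Qed.

Lemma wf_rename d r f : wf d f -> wf d (rename r f).
Proof.
  induction f as [n|c args IH] using form_nested_ind; [auto|].
  simpl rename; rewrite !wf_App, length_map; intros (Hc & Hl & H).
  split; [exact Hc | split; [exact Hl|]].
  intros f Hf; apply in_map_iff in Hf; destruct Hf as (g & <- & Hg); auto.
Qed.

Lemma vars_rename r f x :
  In x (vars (rename r f)) -> exists y, In y (vars f) /\ r y = x.
Proof.
  induction f as [n|c args IH] using form_nested_ind; simpl.
  - intros [<-|[]]; eauto.
  - rewrite flat_map_concat_map, map_map, <- flat_map_concat_map, in_flat_map.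
    intros (g & Hg & Hx); destruct (IH g Hg Hx) as (y & Hy & E).
    exists y; split; [apply in_flat_map; eauto | exact E].
Qed.

(** * Lattice facts *)

Lemma card_pos d : is_L_lattice d -> 0 < card d.
Proof. intros [H _]; exact H. Qed.

(** Lookups out of range return the default 0, which is an element because the carrier is nonempty;
    hence no condition on [c] or [xs]. *)
Lemma elt_op d c xs : is_L_lattice d -> elt d (op d c xs).
Proof.
  intros H; pose proof (card_pos d H) as H0; destruct H as (_ & _ & _ & _ & _ & HT & _).
  unfold op; destruct (Nat.lt_ge_cases c (length (conns d))) as [Hc|Hc].
  - destruct (HT c Hc) as (_ & _ & F); rewrite Forall_forall in F.
    destruct (nth_in_or_default (tuple_index d xs) (table (conn_of d c)) 0) as [Hi| ->];
      [now apply F | exact H0].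
  - unfold conn_of; rewrite (nth_overflow (conns d)) by exact Hc; simpl.
    destruct (tuple_index d xs); exact H0.
Qed.

Lemma elt_eval d v f :
  is_L_lattice d -> (forall n, elt d (v n)) -> elt d (eval d v f).
Proof. intros H Hv; destruct f; simpl; [apply Hv | now apply elt_op]. Qed.

(** Absorption used twice: [x] equals its meet with [join d x (meet d x x)], which is [x] itself. *)
Lemma meet_idem d x : is_L_lattice d -> elt d x -> meet d x x = x.
Proof.
  intros H Hx; pose proof (fun y => elt_op d 1 y H) as HE.
  destruct H as (_ & _ & _ & _ & _ & _ & HL & _).
  destruct (HL x x Hx Hx) as (_ & _ & H1 & _).
  destruct (HL x (meet d x x) Hx (HE _)) as (_ & _ & _ & H2).
  now rewrite H1 in H2.
Qed.

Lemma le_trans_L d x y z :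
  is_L_lattice d -> elt d x -> elt d y -> elt d z ->
  le d x y -> le d y z -> le d x z.
Proof.
  intros (_ & _ & _ & _ & _ & _ & _ & HA & _) Hx Hy Hz; unfold le; intros H1 H2.
  rewrite <- H1 at 1; rewrite <- (proj2 (HA x y z Hx Hy Hz)); now rewrite H2.
Qed.

Lemma join_lub d x y z :
  is_L_lattice d -> elt d x -> elt d y -> elt d z ->
  le d x (join d x y) /\ le d y (join d x y) /\
  (le d x z -> le d y z -> le d (join d x y) z).
Proof.
  intros H Hx Hy Hz; pose proof (fun a b => elt_op d 0 [a; b] H : elt d (join d a b)) as HJ.
  pose proof (fun a b => elt_op d 1 [a; b] H : elt d (meet d a b)) as HM.
  destruct H as (_ & _ & _ & _ & _ & _ & HL & HA & _).
  unfold le; split; [apply HL; auto | split].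
  - destruct (HL x y Hx Hy) as [-> _]; apply HL; auto.
  (* The order is defined by meets; absorption turns it into an equation between joins, to which
     associativity applies. *)
  - assert (K : forall w, elt d w -> meet d w z = w -> join d w z = z).
    { intros w Hw E; rewrite <- E at 1.
      rewrite (proj1 (proj2 (HL w z Hw Hz))), (proj1 (HL _ z (HM _ _) Hz)).
      now apply HL. }
    intros E1 E2.
    assert (E : join d (join d x y) z = z).
    { rewrite <- (proj1 (HA x y z Hx Hy Hz)), (K y), (K x); auto. }
    rewrite <- E; apply HL; [apply HJ | exact Hz].
Qed.

Lemma meet_glb d x y z :
  is_L_lattice d -> elt d x -> elt d y -> elt d z ->
  le d (meet d x y) x /\ le d (meet d x y) y /\
  (le d z x -> le d z y -> le d z (meet d x y)).
Proof.
  intros H Hx Hy Hz; pose proof (fun a b => elt_op d 0 [a; b] H : elt d (join d a b)) as HJ.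
  pose proof (fun a b => elt_op d 1 [a; b] H : elt d (meet d a b)) as HM.
  pose proof (fun x => meet_idem d x H) as HI.
  destruct H as (_ & _ & _ & _ & _ & _ & HL & HA & _).
  unfold le; split; [|split].
  - rewrite (proj1 (proj2 (HL _ x (HM _ _) Hx))), (proj2 (HA x x y Hx Hx Hy)).
    now rewrite HI.
  - rewrite <- (proj2 (HA x y y Hx Hy Hy)); now rewrite HI.
  - intros E1 E2; rewrite (proj2 (HA z x y Hz Hx Hy)); now rewrite E1.
Qed.

Definition supremum_of (R : nat -> nat -> Prop) (d : LData) (N : nat)
  (f : nat -> form) (J : form) : Prop :=
  wf d J /\ (forall x, In x (vars J) -> exists t, t < N /\ In x (vars (f t))) /\
  forall v, (forall n, elt d (v n)) ->
    (forall t, t < N -> R (eval d v (f t)) (eval d v J)) /\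
    (forall z, elt d z -> (forall t, t < N -> R (eval d v (f t)) z) -> R (eval d v J) z).

(* Used with [R := le d] for disjunctions and with the reverse order for conjunctions. *)
Lemma supremum_exists (R : nat -> nat -> Prop) d c N f :
  is_L_lattice d ->
  c < length (conns d) -> arity (conn_of d c) = 2 ->
  (forall x, elt d x -> R x x) ->
  (forall x y z, elt d x -> elt d y -> elt d z -> R x y -> R y z -> R x z) ->
  (forall x y z, elt d x -> elt d y -> elt d z ->
     R x (op d c [x; y]) /\ R y (op d c [x; y]) /\
     (R x z -> R y z -> R (op d c [x; y]) z)) ->
  (forall t, t < S N -> wf d (f t)) ->
  exists J, supremum_of R d (S N) f J.
Proof.
  intros HL Hc Ha Hr Ht Hb; induction N as [|N IH]; intro Hf.
  - exists (f 0); split; [apply Hf; lia | split; [exists 0; split; auto; lia|]].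
    intros v Hv; split; [intros t H | intros z _ H; apply H; lia].
    replace t with 0 by lia; apply Hr, elt_eval; auto.
  - destruct IH as (J & HJ & HV & HE); [auto|].
    exists (App c [J; f (S N)]); split; [|split].
    + apply wf_App; rewrite Ha; repeat split; auto.
      intros g [<-|[<-|[]]]; auto.
    + simpl; intros x Hx; rewrite app_nil_r in Hx; apply in_app_or in Hx.
      destruct Hx as [Hx|Hx]; [|exists (S N); split; auto].
      destruct (HV x Hx) as (t & ? & ?); exists t; split; auto.
    + intros v Hv; destruct (HE v Hv) as [H1 H2]; simpl eval.
      assert (E : forall g, elt d (eval d v g)) by (intro; now apply elt_eval).
      split.
      * intros t Hlt.
        destruct (Hb (eval d v J) (eval d v (f (S N))) _ (E J) (E _) (E J)) as (U1 & U2 & _).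
        destruct (Nat.eq_dec t (S N)) as [->|]; [exact U2|].
        apply Ht with (eval d v J); auto; [now apply elt_op | apply H1; lia].
      * intros z Hz H; apply (Hb _ _ z (E J) (E _) Hz).
        -- apply H2; auto.
        -- apply H; lia.
Qed.

(** An empty disjunction would need a formula for the bottom element, and the signature may have no
    constants; hence [0 < N]. *)
Lemma disjunction_exists d N f :
  is_L_lattice d -> 0 < N -> (forall t, t < N -> wf d (f t)) ->
  exists J, supremum_of (le d) d N f J.
Proof.
  intros H HN Hf; destruct N as [|N]; [lia|].
  apply supremum_exists with (c := 0); auto.
  - destruct H as (_ & H3 & _); lia.
  - destruct H as (_ & _ & E & _); now rewrite E.
  - intros; now apply meet_idem.
  - intros; now apply le_trans_L with y.
  - intros; now apply join_lub.
Qed.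

Lemma conjunction_exists d N f :
  is_L_lattice d -> 0 < N -> (forall t, t < N -> wf d (f t)) ->
  exists J, supremum_of (fun x y => le d y x) d N f J.
Proof.
  intros H HN Hf; destruct N as [|N]; [lia|].
  apply supremum_exists with (c := 1); auto.
  - destruct H as (_ & H3 & _); lia.
  - destruct H as (_ & _ & _ & E & _); now rewrite E.
  - intros; now apply meet_idem.
  - intros; now apply le_trans_L with y.
  - intros; now apply meet_glb.
Qed.

(** * Reduction to boundedly many variables *)

(** Private variables of [a] and of [b] use the same names, from [m] to [m + card d - 1]. The two
    valuations, required to agree only below [m], keep them independent, so tables on both sides
    have the same size. *)
Definition few_variable_interpolation (d : LData) : Prop :=
  forall m a b, m <= card d * card d -> wf d a -> wf d b ->
    (forall x, In x (vars a) -> x < m + card d) ->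
    (forall x, In x (vars b) -> x < m + card d) ->
    (forall v w, (forall j, elt d (v j)) -> (forall j, elt d (w j)) ->
       (forall j, j < m -> v j = w j) -> le d (eval d v a) (eval d w b)) ->
    exists i, wf d i /\ (forall x, In x (vars i) -> x < m) /\
      valid_le d a i /\ valid_le d i b.

Lemma few_variables_of_interpolation d :
  interpolation d -> few_variable_interpolation d.
Proof.
  intros H m a b _ Wa Wb Va Vb Hv; set (n := card d) in *.
  (* The private variables of [b] move past those of [a], so that only indices below [m] can be
     common. *)
  set (r j := if j <? m then j else j + n).
  destruct (H a (rename r b)) as (i & Wi & Vi & Hai & Hib);
    [exact Wa | now apply wf_rename | |].
  { intros v Ev; rewrite eval_rename; apply Hv; auto.
    intros j Hj; unfold r; now rewrite (proj2 (Nat.ltb_lt j m) Hj). }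
  assert (Vm : forall x, In x (vars i) -> x < m).
  { intros x Hx; destruct (Vi x Hx) as [Hxa Hxb]; apply Va in Hxa.
    destruct (vars_rename _ _ _ Hxb) as (y & _ & E); unfold r in E.
    destruct (Nat.ltb_spec y m); lia. }
  exists i; repeat split; auto.
  intros v Ev.
  (* Undoes the shift: the renamed [b] gets the value that [b] has under [v], and nothing changes on
     the variables of [i]. *)
  set (v' j := if j <? m + n then v j else v (j - n)).
  specialize (Hib v' ltac:(intro j; unfold v'; destruct (j <? m + n); apply Ev)).
  rewrite eval_rename in Hib.
  replace (eval d v i) with (eval d v' i).
  replace (eval d v b) with (eval d (fun x => v' (r x)) b); [exact Hib|].
  - apply eval_ext; intros x Hx; apply Vb in Hx; unfold v', r.
    destruct (Nat.ltb_spec x m), (Nat.ltb_spec x (m + n)); try lia; auto.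
    destruct (Nat.ltb_spec (x + n) (m + n)); try lia; f_equal; lia.
  - apply eval_ext; intros x Hx; apply Vm in Hx; unfold v'.
    destruct (Nat.ltb_spec x (m + n)); [reflexivity | lia].
Qed.

Lemma vars_bounded l : exists K, forall x, In x l -> x < K.
Proof.
  exists (S (list_max l)); intros x Hx.
  apply Nat.lt_succ_r; pattern x; revert x Hx; apply Forall_forall.
  now apply list_max_le.
Qed.

Lemma valuation_digits d (v : nat -> nat) K :
  is_L_lattice d -> (forall j, elt d (v j)) ->
  exists t, t < card d ^ K /\ forall j, j < K -> digit (card d) t j = v j.
Proof. intros H Ev; apply digits_exist; [now apply card_pos | intros; apply Ev]. Qed.

Lemma elt_digit d t j : is_L_lattice d -> elt d (digit (card d) t j).
Proof. intro H; now apply digit_lt, card_pos. Qed.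

(* Interpolation between two points: shared variables with the same pair of
   values at [v1] and [v0] are identified, which leaves at most [card d ^ 2] of
   them; the remaining variables of [a] (of [b]) are replaced in all possible
   ways by [card d] variables, taking the disjunction (conjunction). *)
Lemma two_point_interpolant d a b v1 v0 :
  is_L_lattice d -> few_variable_interpolation d ->
  wf d a -> wf d b -> valid_le d a b ->
  (forall j, elt d (v1 j)) -> (forall j, elt d (v0 j)) ->
  exists i, wf d i /\
    (forall x, In x (vars i) -> In x (vars a) /\ In x (vars b)) /\
    (forall v, (forall j, elt d (v j)) ->
       (forall x, In x (vars a) -> In x (vars b) -> v x = v1 x) ->
       le d (eval d v a) (eval d v1 i)) /\
    (forall v, (forall j, elt d (v j)) ->
       (forall x, In x (vars a) -> In x (vars b) -> v x = v0 x) ->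
       le d (eval d v0 i) (eval d v b)).
Proof.
  intros HL HF Wa Wb Hab E1 E0; pose proof (card_pos d HL) as Hn.
  set (n := card d) in *.
  destruct (vars_bounded (vars a ++ vars b)) as [K HK].
  set (Y := filter (fun x => if in_dec Nat.eq_dec x (vars b) then true else false) (vars a)).
  assert (HY : forall x, In x Y <-> In x (vars a) /\ In x (vars b)).
  { intro x; unfold Y; rewrite filter_In; destruct (in_dec _ _ _); intuition discriminate. }
  (* The pair of values as one number; base [n] makes this injective because [v0 y < n]. *)
  set (p y := v1 y * n + v0 y).
  assert (Hp : forall y y', p y = p y' -> v1 y = v1 y' /\ v0 y = v0 y').
  { intros y y' E; unfold p in E; specialize (E0 y) as A; specialize (E0 y') as B.
    unfold elt in *; fold n in A, B.
    rewrite !(Nat.mul_comm _ n) in E; now apply Nat.div_mod_unique in E. }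
  set (G := nodup Nat.eq_dec (map p Y)); set (m := length G).
  assert (Hm : m <= n * n).
  { rewrite <- (length_seq (n * n) 0); apply NoDup_incl_length; [apply NoDup_nodup|].
    intros q Hq; apply nodup_In, in_map_iff in Hq; destruct Hq as (y & <- & _).
    apply in_seq; unfold p; specialize (E1 y); specialize (E0 y).
    unfold elt in *; fold n in E1, E0; nia. }
  (* [rep] picks a shared variable from each class of identified variables; [pi], chosen next, sends
     a shared variable to the index of its class. *)
  destruct (bounded_choice 0 (fun k y => In y Y /\ p y = nth k G 0) m) as [rep Hrep].
  { intros k Hk; pose proof (nth_In G 0 Hk) as Hq.
    apply nodup_In, in_map_iff in Hq; destruct Hq as (y & E & HyY); eauto. }
  destruct (bounded_choice 0 (fun y k => In y Y -> k < m /\ nth k G 0 = p y) K) as [pi Hpi].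
  { intros y _; destruct (classic (In y Y)) as [Hy|]; [|now exists 0].
    destruct (In_nth G (p y) 0) as (k & ? & ?); [|eauto].
    apply nodup_In, in_map_iff; eauto. }
  assert (Hpi' : forall y, In y Y -> pi y < m /\ v1 (rep (pi y)) = v1 y /\
                                     v0 (rep (pi y)) = v0 y).
  { intros y Hy; destruct (Hpi y) as [Hlt E]; auto.
    { apply HK, in_or_app; left; now apply HY. }
    split; [exact Hlt|]; apply Hp; destruct (Hrep _ Hlt) as [_ ->]; exact E. }
  (* The digits of [s] run through all ways of sending the private variables to the [n] new ones. *)
  set (rho s x := if in_dec Nat.eq_dec x Y then pi x else m + digit n s x).
  assert (Hrho : forall s x, rho s x < m + n).
  { intros s x; unfold rho; destruct (in_dec _ _ _) as [Hx|].
    - destruct (Hpi' x Hx); lia.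
    - pose proof (digit_lt n s x Hn); lia. }
  assert (HN : 0 < n ^ K) by (apply Nat.neq_0_lt_0, Nat.pow_nonzero; lia).
  destruct (disjunction_exists d (n ^ K) (fun s => rename (rho s) a) HL HN)
    as (a' & Wa' & Va' & Sa'); [intros; now apply wf_rename|].
  destruct (conjunction_exists d (n ^ K) (fun s => rename (rho s) b) HL HN)
    as (b' & Wb' & Vb' & Sb'); [intros; now apply wf_rename|].
  destruct (HF m a' b' Hm Wa' Wb') as (i & Wi & Vi & Hai & Hib).
  { intros x Hx; destruct (Va' x Hx) as (s & _ & Hs).
    destruct (vars_rename _ _ _ Hs) as (y & _ & <-); apply Hrho. }
  { intros x Hx; destruct (Vb' x Hx) as (s & _ & Hs).
    destruct (vars_rename _ _ _ Hs) as (y & _ & <-); apply Hrho. }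
  { intros v w Ev Ew Hvw.
    apply (Sa' v Ev); [now apply elt_eval|]; intros s Hs.
    apply (Sb' w Ew); [now apply elt_eval|]; intros s' Hs'.
    rewrite !eval_rename.
    (* Glues the two substituted valuations. Shared variables are sent to indices below [m], where
       [v] and [w] agree, so [z] serves both formulas and validity of [a <= b] applies. *)
    set (z x := if in_dec Nat.eq_dec x (vars a) then v (rho s x) else w (rho s' x)).
    rewrite (eval_ext d (fun x => v (rho s x)) z a), (eval_ext d (fun x => w (rho s' x)) z b).
    - apply Hab; intro x; unfold z; destruct (in_dec _ _ _); auto.
    - intros x Hx; unfold z; destruct (in_dec _ _ _) as [Hxa|]; [|reflexivity].
      assert (HxY : In x Y) by now apply HY.
      unfold rho; destruct (in_dec _ _ _) as [_|]; [|contradiction].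
      symmetry; apply Hvw, Hpi', HxY.
    - intros x Hx; unfold z; destruct (in_dec _ _ _); [reflexivity | contradiction]. }
  (* Used for [v1] and [v0] alike. The digits of [s] are the values of [v], and [q] gives the
     variable [m + e] the value [e], so the instance number [s] at [q] has the value of the original
     formula at [v]. *)
  assert (Val : forall v v', (forall j, elt d (v j)) -> (forall j, elt d (v' j)) ->
    (forall y, In y Y -> v' (rep (pi y)) = v' y) ->
    (forall x, In x (vars a) -> In x (vars b) -> v x = v' x) ->
    exists q s, (forall j, elt d (q j)) /\ s < n ^ K /\
      (forall f, (forall x, In x (vars f) -> x < K) ->
         eval d q (rename (rho s) f) = eval d v f) /\
      eval d q i = eval d v' (rename rep i)).
  { intros v v' Ev Ev' Hr Hvv'.
    destruct (valuation_digits d v K HL Ev) as (s & Hs & Es); fold n in Hs, Es.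
    set (q k := if k <? m then v' (rep k) else if k <? m + n then k - m else 0).
    exists q, s; split; [|split; [exact Hs | split]].
    - intro k; unfold q; destruct (Nat.ltb_spec k m); [apply Ev'|].
      destruct (Nat.ltb_spec k (m + n)); unfold elt; fold n; lia.
    - intros f Hf; rewrite eval_rename; apply eval_ext; intros x Hx.
      unfold q, rho; destruct (in_dec _ _ _) as [HxY|].
      + destruct (Hpi' x HxY) as [Hlt _].
        rewrite (proj2 (Nat.ltb_lt _ _) Hlt), Hr by exact HxY.
        symmetry; now apply Hvv'; apply HY.
      + rewrite Es by auto; specialize (Ev x); unfold elt in Ev; fold n in Ev.
        destruct (Nat.ltb_spec (m + v x) m); [lia|].
        destruct (Nat.ltb_spec (m + v x) (m + n)); lia.
    - rewrite eval_rename; apply eval_ext; intros x Hx; unfold q.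
      now rewrite (proj2 (Nat.ltb_lt _ _) (Vi x Hx)). }
  exists (rename rep i); split; [now apply wf_rename | split; [|split]].
  - intros x Hx; destruct (vars_rename _ _ _ Hx) as (k & Hk & <-).
    apply HY, Hrep, Vi, Hk.
  - intros v Ev Hv.
    destruct (Val v v1 Ev E1) as (q & s & Eq & Hs & Ef & Ei); [apply Hpi' | exact Hv |].
    rewrite <- Ei, <- (Ef a) by (intros; apply HK, in_or_app; auto).
    apply le_trans_L with (eval d q a'); try apply elt_eval; auto.
    apply (Sa' q Eq); exact Hs.
  - intros v Ev Hv.
    destruct (Val v v0 Ev E0) as (q & s & Eq & Hs & Ef & Ei); [apply Hpi' | exact Hv |].
    rewrite <- Ei, <- (Ef b) by (intros; apply HK, in_or_app; auto).
    apply le_trans_L with (eval d q b'); try apply elt_eval; auto.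
    apply (Sb' q Eq); exact Hs.
Qed.

(** Points are coded by digit strings below [n ^ K]. For fixed [t0] the disjunction over [t1] lies
    above [a] everywhere, as some disjunct was built for the current point, while at [t0] every
    disjunct lies below [b]. The outer conjunction keeps the first property and gains the second at
    each point from the conjunct built for it. *)
Lemma interpolation_of_few_variables d :
  is_L_lattice d -> few_variable_interpolation d -> interpolation d.
Proof.
  intros HL HF a b Wa Wb Hab; pose proof (card_pos d HL) as Hn; set (n := card d) in *.
  destruct (vars_bounded (vars a ++ vars b)) as [K HK].
  assert (HN : 0 < n ^ K) by (apply Nat.neq_0_lt_0, Nat.pow_nonzero; lia).
  assert (Ed : forall t j, elt d (digit n t j)) by (intros; now apply elt_digit).
  destruct (bounded_choice (Var 0) (fun t0 J => wf d J /\
    (forall x, In x (vars J) -> In x (vars a) /\ In x (vars b)) /\ valid_le d a J /\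
    (forall v, (forall j, elt d (v j)) ->
       (forall x, In x (vars a) -> In x (vars b) -> v x = digit n t0 x) ->
       le d (eval d (digit n t0) J) (eval d v b))) (n ^ K)) as [J HJ].
  { intros t0 _.
    destruct (bounded_choice (Var 0) (fun t1 i => wf d i /\
      (forall x, In x (vars i) -> In x (vars a) /\ In x (vars b)) /\
      (forall v, (forall j, elt d (v j)) ->
         (forall x, In x (vars a) -> In x (vars b) -> v x = digit n t1 x) ->
         le d (eval d v a) (eval d (digit n t1) i)) /\
      (forall v, (forall j, elt d (v j)) ->
         (forall x, In x (vars a) -> In x (vars b) -> v x = digit n t0 x) ->
         le d (eval d (digit n t0) i) (eval d v b))) (n ^ K)) as [I HI].
    { intros t1 _; now apply two_point_interpolant. }
    destruct (disjunction_exists d (n ^ K) I HL HN) as (J & WJ & VJ & SJ);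
      [intros; now apply HI|].
    exists J; split; [exact WJ | split; [|split]].
    - intros x Hx; destruct (VJ x Hx) as (t & Ht & Hx'); now apply (HI t Ht).
    - intros v Ev; destruct (valuation_digits d v K HL Ev) as (t & Ht & Et); fold n in Ht, Et.
      destruct (HI t Ht) as (_ & Vt & At & _).
      apply le_trans_L with (eval d v (I t)); try apply elt_eval; auto.
      + rewrite (eval_ext d v (digit n t) (I t)).
        * apply At; [exact Ev|]; intros x Hx _; symmetry; apply Et, HK, in_or_app; auto.
        * intros x Hx; symmetry; apply Et, HK, in_or_app; left; now apply Vt.
      + now apply (SJ v Ev).
    - intros v Ev Hv; apply SJ; [apply Ed | now apply elt_eval|].
      intros t Ht; apply HI; auto. }
  destruct (conjunction_exists d (n ^ K) J HL HN) as (I & WI & VI & SI);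
    [intros; now apply HJ|].
  exists I; split; [exact WI | split; [|split]].
  - intros x Hx; destruct (VI x Hx) as (t & Ht & Hx'); now apply (HJ t Ht).
  - intros v Ev; apply (SI v Ev); [now apply elt_eval|].
    intros t Ht; now apply (HJ t Ht).
  - intros v Ev; destruct (valuation_digits d v K HL Ev) as (t & Ht & Et); fold n in Ht, Et.
    destruct (HJ t Ht) as (_ & Vt & _ & Bt).
    apply le_trans_L with (eval d v (J t)); try apply elt_eval; auto.
    + now apply (SI v Ev).
    + rewrite (eval_ext d v (digit n t) (J t)).
      * apply Bt; [exact Ev|]; intros x Hx _; symmetry; apply Et, HK, in_or_app; auto.
      * intros x Hx; symmetry; apply Et, HK, in_or_app; left; now apply Vt.
Qed.

(** * Correctness of the decision procedure *)

Definition represents (d : LData) (k a : nat) (f : form) : Prop :=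
  wf d f /\ (forall x, In x (vars f) -> x < k) /\
  forall t, t < card d ^ k -> digit (card d) a t = eval d (digit (card d) t) f.

Lemma nfun_pos d k : is_L_lattice d -> 0 < nfun (card d) k.
Proof.
  intro H; pose proof (card_pos d H); apply Nat.neq_0_lt_0, Nat.pow_nonzero; lia.
Qed.

Lemma table_exists d k f :
  is_L_lattice d ->
  exists g, g < nfun (card d) k /\
    forall t, t < card d ^ k -> digit (card d) g t = eval d (digit (card d) t) f.
Proof.
  intro H; apply digits_exist; [now apply card_pos|].
  intros; apply elt_eval; [exact H|]; intro; now apply elt_digit.
Qed.

Lemma row_index_tuple d M F t k :
  row_index (card d) M F t k =
  tuple_index d (map (fun i => digit (card d) (digit M F i) t) (seq 0 k)).
Proof.
  unfold tuple_index; induction k as [|k IH]; [reflexivity|].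
  rewrite seq_S, map_app, fold_left_app, <- IH; reflexivity.
Qed.

Lemma application_correct d k c F R :
  application (code d) (card d) k c F R = true <->
  forall t, t < card d ^ k -> digit (card d) R t =
    op d c (map (fun i => digit (card d) (digit (nfun (card d) k) F i) t)
              (seq 0 (arity (conn_of d c)))).
Proof.
  unfold application; rewrite ball_true; setoid_rewrite Nat.eqb_eq.
  split; intros H t Ht; specialize (H t Ht);
    rewrite dtable_code, darity_code, row_index_tuple in *; exact H.
Qed.

Lemma clone_closed_correct d k s :
  clone_closed (code d) k s = true <->
  (forall j g, j < k -> g < nfun (card d) k ->
     (forall t, t < card d ^ k -> digit (card d) g t = digit (card d) t j) ->
     member s g = true) /\
  (forall c F R, c < length (conns d) ->
     F < nfun (card d) k ^ arity (conn_of d c) -> R < nfun (card d) k ->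
     (forall i, i < arity (conn_of d c) ->
        member s (digit (nfun (card d) k) F i) = true) ->
     (forall t, t < card d ^ k -> digit (card d) R t =
        op d c (map (fun i => digit (card d) (digit (nfun (card d) k) F i) t)
                  (seq 0 (arity (conn_of d c))))) ->
     member s R = true).
Proof.
  unfold clone_closed; rewrite andb_true_iff, !ball_true, dcard_code.
  apply Morphisms_Prop.and_iff_morphism.
  - split.
    + intros H j g Hj Hg E; specialize (H j Hj); rewrite ball_true in H.
      specialize (H g Hg); rewrite implb_true_iff in H; apply H.
      apply ball_true; intros t Ht; apply Nat.eqb_eq; auto.
    + intros H j Hj; apply ball_true; intros g Hg; apply implb_true_iff; intro E.
      apply (H j g Hj Hg); intros t Ht.
      apply Nat.eqb_eq; revert t Ht; now apply ball_true.
  - split.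
    + intros H c F R Hc HF HR Hm E; pose proof (length_conns_code d).
      specialize (H c ltac:(lia)); rewrite implb_true_iff, ball_true, darity_code in H.
      specialize (H (proj2 (dis_conn_code d c) Hc) F HF).
      rewrite implb_true_iff, !ball_true in H; specialize (H Hm R HR).
      rewrite implb_true_iff in H; now apply H, application_correct.
    + intros H c _; rewrite implb_true_iff, ball_true, darity_code.
      intros Hc F HF; apply dis_conn_code in Hc.
      rewrite implb_true_iff, !ball_true; intros Hm R HR.
      rewrite implb_true_iff, application_correct; intro E.
      now apply (H c F R).
Qed.

(** The set of tables of formulas is itself closed, so its bit mask is one of the sets tested and
    [a] belongs to it. Conversely, induction on the formula puts its table into every closed set. *)
Lemma term_function_correct d k a :
  is_L_lattice d -> a < nfun (card d) k ->
  (term_function (code d) k a = true <-> exists f, represents d k a f).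
Proof.
  intros HL Ha; unfold term_function; rewrite ball_true, dcard_code.
  pose proof (nfun_pos d k HL) as HM.
  set (n := card d) in *; set (M := nfun n k) in *; split.
  - intro H; destruct (bitmask_exists (fun g => exists f, represents d k g f) M) as (s & Hs & Es).
    specialize (H s Hs); rewrite implb_true_iff in H.
    apply Es; [exact Ha|]; apply H; clear H; apply clone_closed_correct; split.
    + intros j g Hj Hg E; apply Es; [exact Hg|]; exists (Var j).
      split; [exact I | split; [intros x [<-|[]]; exact Hj | exact E]].
    + fold n M; intros c F R Hc HF HR Hm E; apply Es; [exact HR|].
      destruct (bounded_choice (Var 0) (fun i f => represents d k (digit M F i) f)
                  (arity (conn_of d c))) as [fs Hfs].
      { intros i Hi; apply Es; [now apply digit_lt | now apply Hm]. }
      exists (App c (map fs (seq 0 (arity (conn_of d c))))); split; [|split].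
      * apply wf_App; rewrite length_map, length_seq; repeat split; auto.
        intros f Hf; apply in_map_iff in Hf; destruct Hf as (i & <- & Hi).
        apply in_seq in Hi; apply Hfs; lia.
      * simpl; intros x Hx; apply in_flat_map in Hx; destruct Hx as (f & Hf & Hx).
        apply in_map_iff in Hf; destruct Hf as (i & <- & Hi).
        apply in_seq in Hi; apply (Hfs i); [lia | exact Hx].
      * intros t Ht; fold n; rewrite E by exact Ht; simpl; f_equal; rewrite map_map.
        apply map_ext_in; intros i Hi; apply in_seq in Hi; apply (Hfs i); [lia | exact Ht].
  - intros (f & Wf & Vf & Ef) s _; apply implb_true_iff; intro Hc.
    apply clone_closed_correct in Hc; fold n M in Hc; destruct Hc as [Hgen Happ].
    (* The code is generalised because the induction hypothesis is needed for the tables of the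
       arguments. *)
    revert a Ha Wf Vf Ef.
    induction f as [j|c args IH] using form_nested_ind; intros g Hg Wf Vf Ef.
    + apply (Hgen j g); auto; apply Vf; simpl; auto.
    + apply wf_App in Wf; destruct Wf as (Hlt & Hlen & Wargs).
      assert (Hin : forall i, i < arity (conn_of d c) -> In (nth i args (Var 0)) args)
        by (intros; apply nth_In; lia).
      (* The tables of the arguments, next packed as the digits of [F] so that closure under [c]
         applies. *)
      destruct (bounded_choice 0 (fun i y => y < M /\ forall t, t < n ^ k ->
         digit n y t = eval d (digit n t) (nth i args (Var 0))) (arity (conn_of d c)))
        as [ys Hys].
      { intros i _; now apply table_exists. }
      destruct (digits_exist M ys (arity (conn_of d c))) as (F & HF & EF);
        [exact HM | intros; now apply Hys |].
      apply (Happ c F g Hlt HF Hg).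
      * intros i Hi; rewrite EF by exact Hi.
        apply (IH (nth i args (Var 0))); [now apply Hin | now apply Hys | now apply Wargs, Hin | |].
        -- intros x Hx; apply Vf; simpl; apply in_flat_map; eauto.
        -- now apply Hys.
      * intros t Ht; specialize (Ef t Ht); fold n in Ef; rewrite Ef; simpl; f_equal.
        rewrite <- Hlen.
        apply nth_ext with (eval d (digit n t) (Var 0)) 0;
          [now rewrite !length_map, length_seq|].
        rewrite length_map; intros i Hi; rewrite map_nth.
        rewrite (nth_indep _ 0 (digit n (digit M F 0) t)) by now rewrite length_map, length_seq.
        rewrite (map_nth (fun i => digit n (digit M F i) t)), seq_nth by exact Hi; simpl.
        rewrite EF by lia; symmetry; apply Hys; [lia | exact Ht].
Qed.

Lemma dle_correct d x y : dle (code d) x y = true <-> le d x y.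
Proof.
  unfold dle; rewrite dtable_code, dcard_code, Nat.eqb_eq; reflexivity.
Qed.

Lemma represents_eval d m k a f v u x :
  is_L_lattice d -> represents d (m + k) a f ->
  u < card d ^ m -> x < card d ^ k ->
  (forall j, j < m -> digit (card d) u j = v j) ->
  (forall j, j < k -> digit (card d) x j = v (m + j)) ->
  digit (card d) a (u + card d ^ m * x) = eval d v f.
Proof.
  intros HL (_ & Vf & Ef) Hu Hx Eu Ex; rewrite Ef by now apply append_lt.
  apply eval_ext; intros j Hj; apply Vf in Hj.
  rewrite digit_append by (auto; now apply card_pos).
  destruct (Nat.ltb_spec j m); [auto|].
  rewrite Ex by lia; f_equal; lia.
Qed.

Lemma interpolation_test_correct d :
  is_L_lattice d ->
  (interpolation_test (code d) = true <-> few_variable_interpolation d).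
Proof.
  intro HL; pose proof (card_pos d HL) as Hn.
  assert (HD : forall t j, elt d (digit (card d) t j)) by (intros; now apply elt_digit).
  assert (HV : forall m v, (forall j, elt d (v j)) -> exists u x,
    u < card d ^ m /\ x < card d ^ card d /\ (forall j, j < m -> digit (card d) u j = v j) /\
    (forall j, j < card d -> digit (card d) x j = v (m + j))).
  { intros m v Ev; destruct (valuation_digits d v m HL Ev) as (u & ? & ?).
    destruct (valuation_digits d (fun j => v (m + j)) (card d) HL) as (x & ? & ?); [auto|].
    exists u, x; auto. }
  assert (HI : forall m i f v u, represents d m i f -> u < card d ^ m ->
    (forall j, j < m -> digit (card d) u j = v j) -> digit (card d) i u = eval d v f).
  { intros m i f v u (_ & Vf & Ef) Hu Eu; rewrite Ef by exact Hu.
    apply eval_ext; auto. }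
  unfold interpolation_test; rewrite ball_true, dcard_code; split.
  - intros H m a b Hm Wa Wb Va Vb Hab.
    destruct (table_exists d (m + card d) a HL) as (ta & Hta & Ea).
    destruct (table_exists d (m + card d) b HL) as (tb & Htb & Eb).
    assert (Ra : represents d (m + card d) ta a) by (repeat split; auto).
    assert (Rb : represents d (m + card d) tb b) by (repeat split; auto).
    specialize (H m ltac:(lia)); rewrite ball_true in H; specialize (H ta Hta).
    rewrite ball_true in H; specialize (H tb Htb); rewrite !implb_true_iff, bex_true in H.
    destruct H as (i & Hi & H).
    { apply term_function_correct; eauto. }
    { apply term_function_correct; eauto. }
    { apply ball_true; intros u Hu; apply ball_true; intros x Hx.
      apply ball_true; intros z Hz; apply dle_correct.
      rewrite Ea, Eb by now apply append_lt.
      apply Hab; auto; intros j Hj.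
      rewrite !digit_append by auto; now rewrite (proj2 (Nat.ltb_lt _ _) Hj). }
    apply andb_true_iff in H; destruct H as [Ht Hs].
    apply term_function_correct in Ht; auto; destruct Ht as [f Rf].
    assert (Hs' : forall v, (forall j, elt d (v j)) ->
      le d (eval d v a) (eval d v f) /\ le d (eval d v f) (eval d v b)).
    { intros v Ev; destruct (HV m v Ev) as (u & x & Hu & Hx & Eu & Ex).
      unfold interpolant_table in Hs; rewrite ball_true in Hs; specialize (Hs u Hu).
      rewrite ball_true in Hs; specialize (Hs x Hx).
      rewrite andb_true_iff, !dle_correct in Hs.
      rewrite (represents_eval d m (card d) ta a v) in Hs by auto.
      rewrite (represents_eval d m (card d) tb b v) in Hs by auto.
      now rewrite (HI m i f v u Rf Hu Eu) in Hs. }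
    exists f; destruct Rf as (Wf & Vf & _); repeat split; auto;
      intros v Ev; now apply Hs'.
  - intros H m Hm; apply ball_true; intros ta Hta; apply ball_true; intros tb Htb.
    rewrite !implb_true_iff, bex_true; intros Ta Tb Hval.
    apply term_function_correct in Ta, Tb; auto.
    destruct Ta as [a Ra], Tb as [b Rb].
    destruct (H m a b) as (f & Wf & Vf & Haf & Hfb);
      [lia | apply Ra | apply Rb | apply Ra | apply Rb | |].
    { intros v w Ev Ew Hvw; destruct (HV m v Ev) as (u & x & Hu & Hx & Eu & Ex).
      (* Only the private values of [w] are extracted; below [m] it agrees with [v], so [u] serves
         both. *)
      destruct (HV m w Ew) as (_ & z & _ & Hz & _ & Ez).
      rewrite <- (represents_eval d m (card d) ta a v u x) by auto.
      rewrite <- (represents_eval d m (card d) tb b w u z)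
        by (auto; intros; rewrite Eu; auto).
      apply dle_correct; unfold valid_table in Hval; rewrite ball_true in Hval.
      specialize (Hval u Hu); rewrite ball_true in Hval; specialize (Hval x Hx).
      rewrite ball_true in Hval; now apply Hval. }
    destruct (table_exists d m f HL) as (i & Hi & Ei); exists i; split; [exact Hi|].
    assert (Rf : represents d m i f) by (repeat split; auto).
    apply andb_true_iff; split; [apply term_function_correct; eauto|].
    apply ball_true; intros u Hu; apply ball_true; intros x Hx.
    rewrite andb_true_iff, !dle_correct.
    (* The valuation coded by the combined point; its first [m] values are the digits of [u], which
       is all that [f] sees. *)
    set (v := digit (card d) (u + card d ^ m * x)).
    assert (Eu : forall j, j < m -> digit (card d) u j = v j).
    { intros j Hj; unfold v; rewrite digit_append by auto.
      now rewrite (proj2 (Nat.ltb_lt _ _) Hj). }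
    rewrite (HI m i f v u Rf Hu Eu).
    destruct Ra as (_ & _ & Ea), Rb as (_ & _ & Eb).
    rewrite Ea, Eb by now apply append_lt.
    split; [apply Haf | apply Hfb]; intro; apply HD.
Qed.

Theorem mainTheorem9 :
  exists p : recf, forall d : LData, is_L_lattice d ->
    (ev p [code d] 1 /\ interpolation d) \/
    (ev p [code d] 0 /\ ~ interpolation d).
Proof.
  destruct decidable_interpolation_test as [p Hp]; exists p; intros d HL.
  specialize (Hp (code d)); pose proof (interpolation_test_correct d HL) as H.
  destruct (interpolation_test (code d)).
  - left; split; [exact Hp | now apply interpolation_of_few_variables, H].
  - right; split; [exact Hp|]; intro HI.
    now apply few_variables_of_interpolation, H in HI.
Qed.
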